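(* Let $n\ge 1$. A decorated permutation $\pi$ of $[2n]$ is the decorated permutation associated to some unit interval positroid on $[2n]$ if and only if $\pi$ is a $2n$-cycle $(1 \ j_1 \ \dots \ j_{2n-1})$ satisfying the following two conditions: (1) in the sequence $(1, j_1, \dots, j_{2n-1})$ the elements $1,\dots,n$ appear in increasing order while the elements $n+1,\dots,2n$ appear in decreasing order; (2) for every $1\le k\le 2n-1$, the set $\{1,j_1,\dots,j_k\}$ contains at least as many elements of $\{1,\dots,n\}$ as elements of $\{n+1,\dots,2n\}$. In particular, there are $\frac{1}{n+1}\binom{2n}{n}$ unit interval positroids on $[2n]$.
   Context: A poset $P$ on $n$ elements is a unit interval order if there is a bijection $i\mapsto[q_i,q_i+1]$ from $P$ to a set of closed unit intervals of $\mathbb{R}$ such that $i<_P j$ iff $q_i+1<q_j$. For a poset $P$ labeled bijectively by $[n]$, the altitude of $i$ is $\alpha(i)=|\{j: j\le_P i\}|-|\{j: i\le_P j\}|$; the labeling is canonical if $\alpha(i)<\alpha(j)$ implies $i<j$ as integers. The antiadjacency matrix of a labeled poset on $[n]$ is the $n\times n$ $0/1$ matrix $A=(a_{i,j})$ with $a_{i,j}=0$ iff $i<_P j$. For an $n\times n$ real matrix $A=(a_{i,j})$, $\psi(A)$ is the $n\times 2n$ matrix whose first $n$ columns form the identity matrix $I_n$ and whose column $n+j$ ($j\in[n]$) has entry $(-1)^{n-i}a_{n+1-i,j}$ in row $i$. The unit interval positroid induced by a unit interval order $P$ is the matroid on ground set $[2n]$ whose bases are the $n$-subsets $K\subseteq[2n]$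 such that the columns of $\psi(A)$ indexed by $K$ are linearly independent, where $A$ is the antiadjacency matrix of $P$ with respect to a canonical labeling; a unit interval positroid on $[2n]$ is a matroid arising this way from some unit interval order on $n$ elements. For a matroid $M$ of rank $d$ on $[N]$ and $i\in[N]$, let $<_i$ be the total order $i<_i i+1<_i\dots<_i N<_i 1<_i\dots<_i i-1$, and let $I_i$ be the lexicographically minimal basis of $M$ with respect to $<_i$; $(I_1,\dots,I_N)$ is the Grassmann necklace of $M$ (indices mod $N$). The decorated permutation associated to $M$ is the permutation $\sigma$ of $[N]$ (with fixed points decorated) defined by: if $I_{i+1}=(I_i\setminus\{i\})\cup\{j\}$ with $j\neq i$ then $\sigma(j)=i$; if $I_{i+1}=I_i$ and $i\notin I_i$ then $i$ is a fixed point marked clockwise; if $I_{i+1}=I_i$ and $i\in I_i$ then $i$ is a fixed point marked counterclockwise. Cycle notation $(1\ j_1\ \dots\ j_{2n-1})$ means $1\mapsto j_1\mapsto j_2\mapsto\dots\mapsto j_{2n-1}\mapsto 1$. *)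

(* Defs.v *)
From HB Require Import structures.
From mathcomp Require Import all_boot all_order all_algebra all_fingroup.
From mathcomp Require Import boolp reals.

Set Implicit Arguments.
Unset Strict Implicit.
Unset Printing Implicit Defensive.

Import Order.TTheory GRing.Theory Num.Theory.

Local Open Scope ring_scope.

(* Convention: [N] = {1, ..., N} is represented by 'I_N = {0, ..., N-1}, so   *)
(* every element is shifted down by one; the set [2n] is 'I_(n + n), and      *)
(* 1, ..., n (resp. n+1, ..., 2n) are the i : 'I_(n + n) with i < n (resp.    *)
(* n <= i).                                                                   *)

(* A matroid, given by its bases: a nonempty family of sets that satisfies    *)
(* the basis exchange axiom.                                                  *)
Definition basis_family (T : finType) (Bs : {set {set T}}) : bool :=
  (Bs != set0) &&
  [forall B1 in Bs, forall B2 in Bs, forall x in B1 :\: B2,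
     exists y in B2 :\: B1, (y |: (B1 :\ x)) \in Bs].

Record matroid (T : finType) := Matroid {
  bases : {set {set T}};
  _ : basis_family bases }.

HB.instance Definition _ (T : finType) := [isSub for @bases T].
HB.instance Definition _ (T : finType) := [Countable of matroid T by <:].
HB.instance Definition _ (T : finType) := [Finite of matroid T by <:].

(* Distinct elements of P correspond to distinct intervals, whence the        *)
(* injectivity of q.                                                          *)
Definition unit_interval_order (R : realType) (d : Order.disp_t)
    (P : finPOrderType d) : Prop :=
  exists q : P -> R,
    injective q /\ forall x y : P, (x < y)%O = (q x + 1 < q y).

Definition altitude (d : Order.disp_t) (P : finPOrderType d) (x : P) : int :=
  #|[set y : P | (y <= x)%O]|%:Z - #|[set y : P | (x <= y)%O]|%:Z.

(* A labeling of P by [n] is given by the bijection e sending a label to the  *)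
(* element of P that carries it.                                              *)
Definition canonical_labeling (d : Order.disp_t) (P : finPOrderType d)
    (n : nat) (e : 'I_n -> P) : Prop :=
  bijective e /\
  forall i j : 'I_n, altitude (e i) < altitude (e j) -> (i < j)%N.

Definition antiadjacency (R : realType) (d : Order.disp_t)
    (P : finPOrderType d) (n : nat) (e : 'I_n -> P) : 'M[R]_n :=
  \matrix_(i, j) (if (e i < e j)%O then 0 else 1).

(* In 0-based indices n - i and n + 1 - i both become n - 1 - i = rev_ord i.  *)
Definition psi (R : realType) (n : nat) (A : 'M[R]_n) : 'M[R]_(n, n + n) :=
  row_mx 1%:M (\matrix_(i, j) ((-1) ^+ rev_ord i * A (rev_ord i) j)).

Definition represented_by (R : realType) (m N : nat) (M : matroid 'I_N)
    (B : 'M[R]_(m, N)) : Prop :=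
  bases M = [set K : {set 'I_N} |
               (#|K| == m) && free [seq col k B | k in K]].

Definition unit_interval_positroid (R : realType) (n : nat)
    (M : matroid 'I_(n + n)) : Prop :=
  exists (d : Order.disp_t) (P : finPOrderType d) (e : 'I_n -> P),
    [/\ unit_interval_order R P, canonical_labeling e
      & represented_by M (psi (antiadjacency R e))].

(* The position (from 0) of a in the order i <_i i+1 <_i ... <_i i-1.         *)
Definition cyclic_rank (N : nat) (i a : 'I_N) : nat := (a + (N - i)) %% N.

Definition cyclic_ranks (N : nat) (i : 'I_N) (B : {set 'I_N}) : seqlexi nat :=
  sort leq [seq cyclic_rank i a | a in B].

Definition lex_min_basis (N : nat) (M : matroid 'I_N) (i : 'I_N)
    (B : {set 'I_N}) : Prop :=
  B \in bases M /\
  forall B' : {set 'I_N}, B' \in bases M ->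
    (cyclic_ranks i B <= cyclic_ranks i B')%O.

Definition Grassmann_necklace (N : nat) (M : matroid 'I_N)
    (I : 'I_N -> {set 'I_N}) : Prop :=
  forall i : 'I_N, lex_min_basis M i (I i).

(* The fixed points in counterclockwise are the counterclockwise ones; all    *)
(* other fixed points are clockwise.                                          *)
Record decorated_perm (N : nat) := DecoratedPerm {
  perm_of :> {perm 'I_N};
  counterclockwise : {set 'I_N};
  _ : counterclockwise \subset [set i | perm_of i == i] }.

(* ordS is the cyclic successor. In the first clause i \in I i is needed:     *)
(* if i \notin I i and I (ordS i) = I i, then the equation of that clause     *)
(* holds for every j \in I i.                                                 *)
Definition associated_perm (N : nat) (M : matroid 'I_N)
    (s : decorated_perm N) : Prop :=
  exists I : 'I_N -> {set 'I_N},
    Grassmann_necklace M I /\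
    forall i : 'I_N,
      [/\ forall j : 'I_N, i \in I i -> j != i ->
            I (ordS i) = j |: (I i :\ i) -> s j = i,
          I (ordS i) = I i -> i \notin I i ->
            s i = i /\ i \notin counterclockwise s
        & I (ordS i) = I i -> i \in I i ->
            s i = i /\ i \in counterclockwise s].

(* c is a cycle notation c_0 |-> c_1 |-> ... |-> c_0 for s as an N-cycle.     *)
Definition full_cycle_notation (N : nat) (s : {perm 'I_N}) (c : seq 'I_N) :
    Prop :=
  [/\ size c = N, uniq c & fcycle s c].

Definition small_increasing_large_decreasing (n : nat) (c : seq 'I_(n + n)) :
    Prop :=
  sorted ltn [seq x <- map val c | (x < n)%N] /\
  sorted gtn [seq x <- map val c | (n <= x)%N].

Definition prefixes_dominated (n : nat) (c : seq 'I_(n + n)) : Prop :=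
  forall k : nat, (1 <= k <= 2 * n - 1)%N ->
    (count (fun x : 'I_(n + n) => n <= x) (take k.+1 c) <=
     count (fun x : 'I_(n + n) => x < n) (take k.+1 c))%N.

(* Main.v *)
Require Import Defs.
From mathcomp Require Import all_boot all_order all_algebra all_fingroup.
From mathcomp Require Import boolp reals.
From mathcomp Require Import zify lra.
From HB Require Import structures.

Set Implicit Arguments.
Unset Strict Implicit.
Unset Printing Implicit Defensive.

Import Order.TTheory GRing.Theory Num.Theory.

Local Open Scope ring_scope.

(* Under a canonical labeling the entry a_ij of the antiadjacency matrix is 0 *)
(* iff i < n - m j, where m is weakly decreasing with n - j <= m j <= n (all  *)
(* indices from 0), and every such m occurs.  Up to signs the columns of      *)
(* psi(A) are then the edges t -- t+1 and 0 -- m j of a graph on the vertices *)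
(* 0, ..., n.  If x is the first element, in the cyclic order after y, such   *)
(* that column y is spanned by the columns from y + 1 to x, then the          *)
(* Grassmann necklace satisfies I_{y+1} = I_y \ {y} u {x}, so that the        *)
(* decorated permutation maps x to y; in the graph x is found by inspection.  *)
(* Following these steps from 0 lists the small elements upwards and the      *)
(* large ones downwards, with n + a inserted after exactly m a small ones,    *)
(* and the bounds n - a <= m a are the condition on the prefixes.  Finally m  *)
(* is determined by the matroid, and the functions m are counted by the       *)
(* reflection principle.                                                      *)

(** * Greedy bases *)

(** The link between matroid and permutation is local. The lexicographically minimal basis is the
    greedy one, made of the elements not spanned by their predecessors ([lex_min_greedy]). Passing
    from the order starting at [y] to the next order therefore only trades [y] for the element [x]
    at which the cyclic interval after [y] first spans [y] ([greedy_step]). For [dyck_mx m],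
    spanning is connectivity in a graph: a path shows that the interval through [x] suffices
    ([pred_edge_mem]), and a cut shows that no shorter one does ([pred_edge_notin]).

    The relation [pred_edge] meets the cycles in [dyck_positions_adjacent]: consecutive elements of
    the cycle attached to [m] satisfy it. This serves both directions, with the cycle built from [m]
    ([dyck_cycle]) or [m] read off the cycle ([cycle_heights]). [associated_permP] then identifies
    the decorated permutation.

    On the order side, [canonical_dyck] and [dyck_intervals] show that the matrices [dyck_mx m] are
    exactly those that arise. For the count, [dyck_mx_basis] recovers [m] from the bases, and
    [size_dyck_seqs] counts the functions [m]. *)

Lemma memv_add_line_exchange (F : fieldType) (vT : vectType F) (U : {vspace vT})
    (u v : vT) :
  u \in (U + <[v]>)%VS -> u \notin U -> v \in (U + <[u]>)%VS.
Proof.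
case/memv_addP=> s sU [w /vlineP[a ->] ->] usN.
have a0 : a != 0.
  by apply: contraNneq usN => ->; rewrite scale0r addr0.
apply/memv_addP; exists (- a^-1 *: s); first exact: memvZ.
exists (a^-1 *: (s + a *: v)); first by apply: memvZ; exact: memv_line.
by rewrite scalerDr scalerA mulVf // scale1r scaleNr addKr.
Qed.

Lemma dim_add_line (F : fieldType) (vT : vectType F) (U : {vspace vT}) (v : vT) :
  v \notin U -> \dim (U + <[v]>) = (\dim U).+1.
Proof.
move=> vU; apply/eqP; rewrite eqn_leq; apply/andP; split.
  apply: leq_trans (leq_of_leqif (dimv_add_leqif U <[v]>)) _.
  by rewrite dim_vline -addn1 leq_add2l; case: (v == 0).
rewrite ltn_neqAle dimvS ?addvSl // andbT.
apply: contra vU => /eqP dUv.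
have /eqP-> : U == (U + <[v]>)%VS by rewrite eqEdim addvSl dUv /=.
by apply: (subvP (addvSr U _)); exact: memv_line.
Qed.

(** Only heads need comparing: if the head of [s'] were smaller than [x], the threshold [x] would
    count an entry of [s'] and none of [s]. Equal heads cancel in the counts. *)
Lemma lexi_le_count (s s' : seq nat) :
  sorted leq s -> sorted leq s' -> size s = size s' ->
  (forall t, count (fun x => x < t) s' <= count (fun x => x < t) s)%N ->
  ((s : seqlexi nat) <= s')%O.
Proof.
elim: s s' => [|x s IH] [|x' s'] //= hs hs' [sz] cnt.
have le_head y r : path leq y r -> count (fun x => x < y)%N r = 0.
  rewrite path_sortedE; last exact: leq_trans.
  case/andP=> /allP hr _; apply/eqP; rewrite -leqn0 leqNgt -has_count.
  by apply/hasPn=> z /hr; rewrite -leqNgt.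
rewrite lexi_cons leEnat.
have xx' : (x <= x')%N.
  rewrite leqNgt; apply/negP=> x'x.
  have := cnt x; rewrite (le_head _ _ hs) x'x ltnn; lia.
rewrite xx' /=; apply/implyP=> x'x.
have exx : x = x' by apply/eqP; rewrite eqn_leq xx'.
apply: IH => //; [exact: path_sorted hs|exact: path_sorted hs'|].
by move=> t; have := cnt t; rewrite exx leq_add2l.
Qed.

Section ColumnSpan.
Variables (F : fieldType) (vT : vectType F) (T : finType) (c : T -> vT).
Implicit Types (S K : {set T}).

Definition cspan S := <<[seq c k | k in S]>>%VS.

Lemma cspanP S (U : {vspace vT}) :
  reflect (forall k, k \in S -> c k \in U) (cspan S <= U)%VS.
Proof.
apply: (iffP span_subvP) => [h k kS|h u /imageP[k kS ->]]; last exact: h.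
by apply: h; apply: image_f.
Qed.

Lemma mem_cspan S k : k \in S -> c k \in cspan S.
Proof. by move=> kS; apply: memv_span; apply: image_f. Qed.

Lemma cspanS S S' : S \subset S' -> (cspan S <= cspan S')%VS.
Proof. by move/subsetP=> h; apply/cspanP=> k /h; exact: mem_cspan. Qed.

Lemma cspanU S S' : cspan (S :|: S') = (cspan S + cspan S')%VS.
Proof.
apply/eqP; rewrite eqEsubv; apply/andP; split; last first.
  by rewrite subv_add !cspanS // ?subsetUl ?subsetUr.
apply/cspanP=> k; rewrite inE => /orP[] /mem_cspan.
  exact: (subvP (addvSl _ _)).
exact: (subvP (addvSr _ _)).
Qed.

Lemma cspan1 k : cspan [set k] = <[c k]>%VS.
Proof.
apply/eqP; rewrite eqEsubv; apply/andP; split.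
  by apply/cspanP=> l; rewrite inE => /eqP->; exact: memv_line.
by rewrite -memvE mem_cspan // set11.
Qed.

Lemma cspanU1 k S : cspan (k |: S) = (cspan S + <[c k]>)%VS.
Proof. by rewrite setUC cspanU cspan1. Qed.

Lemma dim_cspan S : (\dim (cspan S) <= #|S|)%N.
Proof. by apply: leq_trans (dim_span _) _; rewrite size_image. Qed.

Lemma free_cspan K : free [seq c k | k in K] = (\dim (cspan K) == #|K|).
Proof. by rewrite /free size_image. Qed.

Lemma free_subset K K' :
  K' \subset K -> free [seq c k | k in K] -> free [seq c k | k in K'].
Proof.
move=> K'K; rewrite !free_cspan => /eqP fK.
rewrite eqn_leq dim_cspan /=.
have := leq_of_leqif (dimv_add_leqif (cspan (K :&: K')) (cspan (K :\: K'))).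
rewrite -cspanU setID fK.
have := dim_cspan (K :\: K'); have := cardsID K' K.
rewrite (setIidPr K'K); lia.
Qed.

Lemma free_setU1 K k :
  free [seq c k | k in K] -> c k \notin cspan K -> free [seq c k | k in k |: K].
Proof.
rewrite !free_cspan => /eqP fK ck; rewrite cspanU1 dim_add_line // fK cardsU1.
by rewrite (contra _ ck) ?add1n // => /mem_cspan.
Qed.

Section Greedy.
Variables (o : T -> nat) (o_inj : injective o).

Definition oseg t := [set a | o a < t]%N.
Definition greedy := [set a | c a \notin cspan (oseg (o a))].

(** Induction along the order: the next element either lies in the current span, and changes neither
    side, or is greedy and raises the dimension by one. *)
Lemma greedyP t :
  cspan (greedy :&: oseg t) = cspan (oseg t) /\
  \dim (cspan (oseg t)) = #|greedy :&: oseg t|.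
Proof.
elim: t => [|t [IH1 IH2]].
  have -> : oseg 0 = set0 by apply/setP=> a; rewrite !inE.
  rewrite setI0 cards0; split => //; apply/eqP; rewrite -leqn0.
  by apply: leq_trans (dim_cspan _) _; rewrite cards0.
have [a /eqP oa|noa] := pickP (fun a => o a == t); last first.
  suff -> : oseg t.+1 = oseg t by [].
  by apply/setP=> a; rewrite !inE ltnS leq_eqVlt noa.
have -> : oseg t.+1 = a |: oseg t.
  apply/setP=> b; rewrite !inE ltnS leq_eqVlt; congr (_ || _).
  by rewrite -oa (inj_eq o_inj).
have naseg : a \notin oseg t by rewrite inE oa ltnn.
have aG : (a \in greedy) = (c a \notin cspan (oseg t)) by rewrite inE oa.
rewrite setIUr cspanU1; case: (boolP (c a \in cspan (oseg t))) => ca.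
  have -> : greedy :&: [set a] = set0.
    apply/setP=> b; rewrite !inE; apply/negP=> /andP[bG /eqP ba].
    by move: bG; rewrite ba oa ca.
  by rewrite set0U IH1 -IH2 (addv_idPl _) // -memvE.
have -> : greedy :&: [set a] = [set a].
  apply/setIidPr/subsetP=> b; rewrite !inE => /eqP ->; by rewrite oa.
rewrite cspanU1 IH1 dim_add_line // cardsU1 IH2; split=> //.
by rewrite !inE oa ltnn andbF.
Qed.

(** An independent subset of an initial segment is bounded by the dimension of its span, which the
    greedy set attains in every segment at once; this is why the greedy basis is minimal. *)
Lemma card_oseg_greedy K t : free [seq c k | k in K] ->
  (#|K :&: oseg t| <= #|greedy :&: oseg t|)%N.
Proof.
move/(free_subset (subsetIl K (oseg t))); rewrite free_cspan => /eqP <-.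
by have [_ <-] := greedyP t; rewrite dimvS // cspanS // subsetIr.
Qed.

Lemma oseg_big : exists t, oseg t = setT.
Proof.
exists (\max_a o a).+1; apply/setP=> a; rewrite !inE ltnS; exact: leq_bigmax.
Qed.

Lemma card_greedy : #|greedy| = \dim (cspan setT).
Proof. by have [t ht] := oseg_big; have [_] := greedyP t; rewrite ht setIT. Qed.

Lemma free_greedy : free [seq c k | k in greedy].
Proof.
have [t ht] := oseg_big; have [] := greedyP t.
by rewrite ht setIT free_cspan => -> ->.
Qed.

Lemma greedy_lexi_min K : free [seq c k | k in K] -> #|K| = #|greedy| ->
  ((sort leq [seq o a | a in greedy] : seqlexi nat)
     <= sort leq [seq o a | a in K])%O.
Proof.
move=> fK cK; apply: lexi_le_count.
- exact: (sort_sorted leq_total).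
- exact: (sort_sorted leq_total).
- by rewrite !size_sort !size_image.
have cntE (S : {set T}) t :
    count (fun x => x < t)%N (sort leq [seq o a | a in S]) = #|S :&: oseg t|.
  rewrite (seq.permP (permEl (perm_sort leq _))) count_map -sum1_card -sum1_count.
  rewrite big_enum_cond; apply: eq_bigl => a.
  by rewrite !inE.
by move=> t; rewrite !cntE; exact: card_oseg_greedy.
Qed.

Lemma sort_image_inj (K K' : {set T}) :
  sort leq [seq o a | a in K] = sort leq [seq o a | a in K'] -> K = K'.
Proof.
move=> e; apply/setP=> a.
have memE (S : {set T}) : (a \in S) = (o a \in sort leq [seq o a | a in S]).
  by rewrite mem_sort (mem_image o_inj).
by rewrite (memE K) (memE K') e.
Qed.

End Greedy.
End ColumnSpan.

(** * Necklace of a represented matroid *)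

Lemma cyclic_rankE (N : nat) (i a : 'I_N) :
  cyclic_rank i a = if (i <= a)%N then (a - i)%N else (a + N - i)%N.
Proof.
rewrite /cyclic_rank; have := ltn_ord i; have := ltn_ord a => aN iN.
case: ifP => ia; last by rewrite modn_small; lia.
have -> : (a + (N - i) = (a - i) + N)%N by lia.
by rewrite modnDr modn_small; lia.
Qed.

Lemma cyclic_rank_inj (N : nat) (i : 'I_N) : injective (cyclic_rank i).
Proof.
move=> a b; rewrite !cyclic_rankE => e; apply: ord_inj.
have := ltn_ord i; have := ltn_ord a; have := ltn_ord b; move: e; do 2 case: ifP => ?; lia.
Qed.

Lemma ordSE (N : nat) (i : 'I_N) :
  (ordS i : nat) = (if i.+1 == N then 0 else i.+1)%N.
Proof.
rewrite /=; have := ltn_ord i; case: eqP => [->|h] iN; first by rewrite modnn.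
by rewrite modn_small; lia.
Qed.

Lemma cyclic_rank_ordS (N : nat) (i a : 'I_N) :
  cyclic_rank (ordS i) a = (if a == i then N.-1 else (cyclic_rank i a).-1)%N.
Proof.
rewrite !cyclic_rankE ordSE -val_eqE /=.
have := ltn_ord i; have := ltn_ord a.
case: (_ =P N) => ?; case: (_ =P _ :> nat) => ?; rewrite ?leq0n; repeat case: ifP => ?; lia.
Qed.

(** The bound is strict: for [x] other than [y], the bound [(cyclic_rank y x).+1] gives the cyclic
    interval after [y] through [x], and [cyclic_rank y x] leaves [x] out. The value [t = N] gives
    everything but [y]. *)
Definition cyclic_between (N : nat) (y : 'I_N) (t : nat) : {set 'I_N} :=
  [set b | (0 < cyclic_rank y b < t)%N].

Lemma dim_full_col (F : fieldType) (m : nat) : \dim {:'cV[F]_m} = m.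
Proof. by rewrite dimvf dim_matrix; exact: muln1. Qed.

Section RepresentedMatroid.
Variables (R : realType) (m N : nat) (B : 'M[R]_(m, N)).
Notation c := (fun k => col k B).

Definition mx_bases : {set {set 'I_N}} :=
  [set K : {set 'I_N} | (#|K| == m) && free [seq col k B | k in K]].

Lemma basis_cspan (K : {set 'I_N}) : K \in mx_bases -> cspan c K = fullv.
Proof.
rewrite inE => /andP[/eqP cK]; rewrite (free_cspan c) cK => /eqP dK.
by apply/eqP; rewrite eqEdim subvf dK dim_full_col leqnn.
Qed.

Lemma cspan_basis (K : {set 'I_N}) :
  #|K| = m -> cspan c K = fullv -> K \in mx_bases.
Proof.
move=> cK fK; rewrite inE cK eqxx (free_cspan c) fK cK.
by rewrite dim_full_col eqxx.
Qed.

Lemma mx_basis_family : cspan c setT = fullv -> basis_family mx_bases.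
Proof.
move=> full; apply/andP; split.
  apply/set0Pn; exists (greedy c (fun i : 'I_N => i : nat)).
  rewrite inE (free_greedy c val_inj) (card_greedy c val_inj) full.
  by rewrite dim_full_col eqxx.
apply/forall_inP=> B1 hB1; apply/forall_inP=> B2 hB2; apply/forall_inP=> x.
rewrite inE => /andP[xB2 xB1].
have := hB1; rewrite inE => /andP[/eqP cB1 fB1].
have fB1x := free_subset (subsetDl B1 [set x]) fB1.
have cB1x : #|B1 :\ x| = m.-1 by have := cardsD1 x B1; rewrite xB1 cB1; lia.
have m0 : (0 < m)%N by rewrite -cB1; apply/card_gt0P; exists x.
(* Without [x], the set [B1] spans only dimension m - 1, so it cannot span all of the basis [B2]. *)
have [/forall_inP h|] := boolP [forall y in B2, c y \in cspan c (B1 :\ x)].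
  have /cspanP := h; rewrite (basis_cspan hB2) => /dimvS.
  rewrite dim_full_col.
  have := dim_cspan c (B1 :\ x); rewrite cB1x; lia.
rewrite negb_forall_in => /exists_inP[y yB2 hy].
have yB1x : y \notin B1 :\ x by apply: contra hy; exact: mem_cspan.
apply/exists_inP; exists y.
  rewrite inE yB2 andbT; apply: contra yB1x => yB1; rewrite !inE yB1 andbT.
  by apply: contraNneq xB2 => <-.
rewrite inE cardsU1 yB1x cB1x add1n prednK // eqxx.
exact: (free_setU1 fB1x hy).
Qed.

Lemma matroid_of_mx : cspan c setT = fullv ->
  exists M : matroid 'I_N, represented_by M B.
Proof. by move=> /mx_basis_family h; exists (Matroid h). Qed.

Variable M : matroid 'I_N.
Hypotheses (MB : represented_by M B) (full : cspan c setT = fullv).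

Lemma lex_min_greedy i (K : {set 'I_N}) :
  lex_min_basis M i K <-> K = greedy c (cyclic_rank i).
Proof.
have oi := @cyclic_rank_inj N i.
set G := greedy _ _.
have cG : #|G| = m.
  by rewrite (card_greedy c oi) full dim_full_col.
have GB : G \in bases M.
  by rewrite MB inE cG eqxx /=; exact: (free_greedy c oi).
have Gmin (K' : {set 'I_N}) : K' \in bases M ->
    (cyclic_ranks i G <= cyclic_ranks i K')%O.
  rewrite MB inE => /andP[/eqP cK' fK'].
  by apply: (greedy_lexi_min oi fK'); rewrite cK' cG.
split=> [[KB Kmin]|->]; last by split.
apply: (sort_image_inj oi).
by apply: (@le_anti _ (seqlexi nat)); rewrite Kmin // Gmin.
Qed.

(* The matroid closure of the cyclic interval after y first contains y when   *)
(* x is reached.                                                              *)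
Lemma greedy_step (x y : 'I_N) :
  let t := cyclic_rank y x in
  c y \in cspan c (cyclic_between y t.+1) ->
  c y \notin cspan c (cyclic_between y t) ->
  [/\ y \in greedy c (cyclic_rank y), x \notin greedy c (cyclic_rank y)
    & greedy c (cyclic_rank (ordS y)) = x |: (greedy c (cyclic_rank y) :\ y)].
Proof.
move=> t hin hout.
set J := cyclic_between y in hin hout.
have ryy : cyclic_rank y y = 0 by rewrite cyclic_rankE leqnn subnn.
have xy : x != y.
  apply: contraTneq hin => xy; rewrite /t xy ryy.
  suff -> : J 1 = J t by [].
  by apply/setP=> b; rewrite !inE /t xy ryy; lia.
have rpos k : k != y -> (0 < cyclic_rank y k)%N.
  move=> ky; rewrite lt0n; apply: contra ky => /eqP k0.
  by apply/eqP/(@cyclic_rank_inj N y); rewrite k0 ryy.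
have JS s s' : (s <= s')%N -> (cspan c (J s) <= cspan c (J s'))%VS.
  by move=> ss'; apply: cspanS; apply/subsetP=> b; rewrite !inE; lia.
have cy0 s : c y \in cspan c (J s) -> (t < s)%N.
  by move=> ys; rewrite ltnNge; apply: contra hout => /JS/subvP; apply.
have J1 k : k != y -> oseg (cyclic_rank y) (cyclic_rank y k)
    = y |: J (cyclic_rank y k).
  move=> ky; apply/setP=> b; rewrite !inE.
  by case: (b =P y) => [->|/eqP/rpos ->]; rewrite ?ryy ?rpos.
have J2 k : k != y -> oseg (cyclic_rank (ordS y)) (cyclic_rank (ordS y) k)
    = J (cyclic_rank y k).
  move=> ky; apply/setP=> b; rewrite !inE !cyclic_rank_ordS (negbTE ky).
  case: (b =P y) => [->|/eqP/rpos]; have := rpos _ ky; rewrite ?ryy.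
    rewrite cyclic_rankE; have := ltn_ord k; have := ltn_ord y; case: ifP; lia.
  lia.
have Jfull : J N = setT :\ y.
  apply/setP=> b; rewrite !inE andbT; case: (b =P y) => [->|/eqP by_].
    by rewrite ryy.
  rewrite rpos // cyclic_rankE; have := ltn_ord b; have := ltn_ord y.
  by case: ifP; lia.
have tN : (t.+1 <= N)%N.
  rewrite /t cyclic_rankE; have := ltn_ord x; have := ltn_ord y; case: ifP; lia.
(* The predecessors of [k] in the two orders differ by [y] alone, so the status of [k] can change
   only where column [y] matters. *)
have G1 k : k != y -> (k \in greedy c (cyclic_rank y)) =
    (c k \notin (cspan c (J (cyclic_rank y k)) + <[c y]>)%VS).
  by move=> ky; rewrite inE J1 // cspanU1.
have G2 k : k != y -> (k \in greedy c (cyclic_rank (ordS y))) =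
    (c k \notin cspan c (J (cyclic_rank y k))).
  by move=> ky; rewrite inE J2.
have JU k : k != y ->
    cspan c (J (cyclic_rank y k).+1) = (cspan c (J (cyclic_rank y k)) + <[c k]>)%VS.
  move=> ky; rewrite -cspanU1; congr cspan; apply/setP=> b; rewrite !inE.
  rewrite ltnS [(_ <= cyclic_rank y k)%N]leq_eqVlt (inj_eq (@cyclic_rank_inj N y)).
  by case: (b =P k) => [->|_] /=; first by rewrite rpos /= ?eqxx. 
have yG : y \in greedy c (cyclic_rank y).
  rewrite inE ryy; apply: contra hout => h0; apply: (subvP (cspanS c _)) h0.
  by apply/subsetP=> b; rewrite inE.
have xG : x \notin greedy c (cyclic_rank y).
  rewrite G1 // negbK; move: hin; rewrite JU // => /memv_add_line_exchange; exact.
split=> //; apply/setP=> k; rewrite !inE.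
have [->|ky] := eqVneq k y.
  rewrite (eq_sym y) (negbTE xy) /=; apply/negbF.
  have -> : oseg (cyclic_rank (ordS y)) (cyclic_rank (ordS y) y) = J N.
    rewrite Jfull; apply/setP=> b; rewrite !inE !cyclic_rank_ordS eqxx andbT.
    have := ltn_ord b; have := ltn_ord y; have := rpos b.
    case: (b =P y) => [->|] /=; rewrite ?ltnn // => _ /(_ isT).
    rewrite cyclic_rankE; case: ifP; lia.
  exact: (subvP (JS _ _ tN)).
rewrite J2 // J1 // cspanU1.
have [->|kx] := eqVneq k x.
  apply/idP; apply: contra hout => xJ.
  by move: hin; rewrite JU // (addv_idPl _) // -memvE.
congr (~~ _); apply/idP/idP => [h|h]; first exact: (subvP (addvSl _ _)) h.
have [tk|kt] := ltnP t (cyclic_rank y k).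
  by move: h; rewrite (addv_idPl _) // -memvE; exact: (subvP (JS _ _ tk)).
(* For [k] before [x], exchange would put column [y] in the span of the interval through [k],
   contradicting the choice of [x]. *)
apply/negPn/negP=> kJ; have := memv_add_line_exchange h kJ.
rewrite -JU // => /cy0; rewrite ltnS => tk.
have : cyclic_rank y k = t by apply/eqP; rewrite eqn_leq kt.
by move/(@cyclic_rank_inj N y)/eqP; rewrite (negbTE kx).
Qed.

End RepresentedMatroid.

(** * The graphic matroid of a height function *)

(** A Dyck path: with small elements as up steps and large ones as down steps, [n + a] is the (n -
    a)-th down step and comes after [m a] up steps. *)
Definition dyck (n : nat) (m : nat -> nat) : Prop :=
  (forall a b, (a <= b < n)%N -> (m b <= m a)%N) /\
  (forall a, (a < n)%N -> (n - a <= m a <= n)%N).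

(* [pred_edge n m x y]: x is the last element, in the cyclic order starting   *)
(* after y, needed to span column y of the matrix [dyck_mx m] below.          *)
Definition pred_edge (n : nat) (m : nat -> nat) (x y : nat) : Prop :=
  [\/ [/\ n <= y, x = y.+1, x < n + n & m (x - n) = m (y - n)],
      [/\ n <= y, x < n, m (y - n) = x.+1
        & forall b, y - n < b < n -> m b < m (y - n)],
      [/\ y < n, n <= x < n + n, m (x - n) = y \/ (y = 0 /\ x = n)
        & forall b, b < x - n -> y < m b]
    | [/\ y < n, y = x.+1 & forall b, b < n -> m b != y]]%N.

Section DyckMatrix.
Variables (R : realType) (n : nat).

(* In the basis of the differences of consecutive [vertex k], the columns of  *)
(* [dyck_mx m] are the edges t -- t+1 and 0 -- m j of a graph on 0, ..., n.   *)
Definition vertex (k : nat) : 'cV[R]_n :=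
  \col_i ((-1) ^+ rev_ord i * (i < k)%:R).

Definition dyck_mx (m : nat -> nat) : 'M[R]_(n, n + n) :=
  row_mx 1%:M (\matrix_(i, j) ((-1) ^+ rev_ord i * (i < m j)%:R)).

Lemma vertex0 : vertex 0 = 0.
Proof. by apply/colP=> i; rewrite !mxE mulr0. Qed.

Lemma col_lshift_dyck_mx m (t : 'I_n) :
  col (lshift n t) (dyck_mx m) = (-1) ^+ rev_ord t *: (vertex t.+1 - vertex t).
Proof.
rewrite colKl; apply/colP=> i; rewrite !mxE -mulrBr ltnS.
have [->|it] := eqVneq i t; first by rewrite leqnn ltnn subr0 mulr1 -expr2 sqrr_sign.
by rewrite [(i <= t)%N]leq_eqVlt val_eqE (negbTE it) /= subrr !mulr0.
Qed.

Lemma col_rshift_dyck_mx m (a : 'I_n) :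
  col (rshift n a) (dyck_mx m) = vertex (m a).
Proof. by rewrite colKr; apply/colP=> i; rewrite !mxE. Qed.

Lemma mem_col_dyck_mx m (U : {vspace 'cV[R]_n}) (x : 'I_(n + n)) :
  (col x (dyck_mx m) \in U) =
  if (x < n)%N then vertex x.+1 - vertex x \in U else vertex (m (x - n)%N) \in U.
Proof.
case: ifP => xn.
  have := col_lshift_dyck_mx m (Ordinal xn).
  have -> : lshift n (Ordinal xn) = x by apply: ord_inj.
  by move=> ->; rewrite rpredZsign.
have xn' : (x - n < n)%N by have := ltn_ord x; lia.
rewrite -(col_rshift_dyck_mx m (Ordinal xn')).
by congr (col _ _ \in U); apply: ord_inj => /=; lia.
Qed.

(* The potential difference of p vanishes exactly along the edges within a    *)
(* level set of p.                                                            *)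
Definition cut (p : nat -> bool) : {vspace 'cV[R]_n} :=
  lker (linfun (mulmx
    (\row_i ((-1) ^+ rev_ord i * ((p i.+1)%:R - (p i)%:R : R))))).

(** The signs cancel and the sum telescopes, so the linear form sends [vertex j] to p j - p 0. *)
Lemma mem_cut p k l : (k <= n)%N -> (l <= n)%N ->
  (vertex k - vertex l \in cut p) = (p k == p l).
Proof.
move=> kn ln; rewrite memv_ker lfunE /= mulmxBr.
have val j : (j <= n)%N -> (\row_i ((-1) ^+ rev_ord i * ((p i.+1)%:R - (p i)%:R : R)))
    *m vertex j = ((p j)%:R - (p 0)%:R : R)%:M.
  move=> jn; rewrite [LHS]mx11_scalar; congr (_%:M); rewrite !mxE.
  transitivity (\sum_(i < n | (i < j)%N) ((p i.+1)%:R - (p i)%:R : R)).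
    rewrite [RHS]big_mkcond; apply: eq_bigr => i _; rewrite !mxE mulrACA.
    by rewrite -expr2 sqrr_sign mul1r; case: ifP; rewrite ?mulr1 ?mulr0.
  rewrite -(big_ord_widen _ (fun i => (p i.+1)%:R - (p i)%:R : R) jn).
  by rewrite -(big_mkord xpredT (fun i => (p i.+1)%:R - (p i)%:R : R)) telescope_sumr.
rewrite !val // -raddfB /= opprB addrA subrK.
apply/eqP/eqP => [/matrixP/(_ 0 0)|->]; last by rewrite subrr raddf0.
rewrite !mxE eqxx mulr1n => /eqP; rewrite subr_eq0.
by case: (p k); case: (p l); rewrite ?[0 == _]eq_sym ?oner_eq0.
Qed.

Lemma vertexB_mem (U : {vspace 'cV[R]_n}) k l : (l <= k)%N ->
  (forall t, (l <= t < k)%N -> vertex t.+1 - vertex t \in U) ->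
  vertex k - vertex l \in U.
Proof.
move=> lk h; rewrite -telescope_sumr //.
by rewrite big_nat; apply: memv_suml => t; exact: h.
Qed.

Lemma lshift_cols_full m (U : {vspace 'cV[R]_n}) :
  (forall t : 'I_n, col (lshift n t) (dyck_mx m) \in U) -> U = fullv.
Proof.
move=> h; apply/eqP; rewrite eqEsubv subvf /=; apply/subvP=> v _.
have -> : v = \sum_(t < n) v t 0 *: col (lshift n t) (dyck_mx m).
  rewrite {1}[v]matrix_sum_delta; apply: eq_bigr => t _.
  by rewrite big_ord1 colKl col1.
by apply: memv_suml => t _; apply: memvZ.
Qed.

Lemma dyck_mx_full m : cspan (fun k => col k (dyck_mx m)) setT = fullv.
Proof.
apply: (@lshift_cols_full m) => t.
exact: (@mem_cspan _ _ _ (fun k => col k (dyck_mx m))).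
Qed.

Section Step.
Variables (m : nat -> nat) (x y : 'I_(n + n)).
Hypotheses (dm : dyck n m) (xy : pred_edge n m x y).
Notation c := (fun k => col k (dyck_mx m)).

(** A path joins the ends of edge [y] by later columns through [x]. A large [y] has the parallel
    chord [x], or the path 0, ..., x + 1 after wrapping around. A small [y] climbs from y + 1 to [n]
    and takes the chord 0 -- n (the bounds force [m 0 = n]). From 0 it reaches vertex [y] by the
    chord [x], or along the edges through [x], or is already there when [y] is 0. *)
Lemma pred_edge_mem :
  c y \in cspan c (cyclic_between y (cyclic_rank y x).+1).
Proof.
set U := cspan _ _; have yN := ltn_ord y; have xN := ltn_ord x.
have inU (k : 'I_(n + n)) : (0 < cyclic_rank y k <= cyclic_rank y x)%N ->
    if (k < n)%N then vertex k.+1 - vertex k \in U else vertex (m (k - n)%N) \in U.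
  move=> h; rewrite -(mem_col_dyck_mx m).
  by apply: (@mem_cspan _ _ _ c); rewrite inE ltnS.
have edgeU k (kn : (k < n)%N) :
    (if (y <= x)%N then y < k <= x else (y < k) || (k <= x))%N ->
    vertex k.+1 - vertex k \in U.
  move=> h; have := inU (lshift n (Ordinal kn)); rewrite /= kn; apply.
  rewrite !cyclic_rankE /=; move: h; repeat case: ifP => ?; lia.
have chordU k (kn : (k < n)%N) :
    (if (y <= x)%N then y < n + k <= x else (y < n + k) || (n + k <= x))%N ->
    vertex (m k) \in U.
  move=> h; have := inU (rshift n (Ordinal kn)).
  rewrite /= [(n + k < n)%N]ltnNge leq_addr /= addKn; apply.
  rewrite !cyclic_rankE /=; move: h; repeat case: ifP => ?; lia.
have m0 : (0 < n)%N -> m 0 = n by move=> n0; have := dm.2 0%N n0; lia.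
rewrite mem_col_dyck_mx; case: xy => [][].
- move=> ny xy1 _ mxy; rewrite ltnNge ny /= -mxy; apply: chordU; first by lia.
  case: ifP; lia.
- move=> ny xn mxy _; rewrite ltnNge ny /= mxy -[vertex _]subr0 -vertex0.
  apply: vertexB_mem => // t tx; apply: edgeU; first by lia.
  case: ifP; lia.
- move=> yn nx mxy _; rewrite yn.
  have n0 : (0 < n)%N by lia.
  have hn : vertex n \in U by have := chordU 0%N n0; rewrite (m0 n0); apply; case: ifP; lia.
  have hyn : vertex n - vertex y.+1 \in U.
    by apply: vertexB_mem => // t ty; apply: edgeU; [lia|case: ifP; lia].
  have hy : vertex y \in U.
    case: mxy => [<-|[-> _]]; last by rewrite vertex0 mem0v.
    by apply: chordU; [lia|case: ifP; lia].
  have -> : vertex y.+1 - vertex y = vertex n - (vertex n - vertex y.+1) - vertex y.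
    by rewrite opprB addrCA subrr addr0.
  by apply: memvB => //; apply: memvB.
- move=> yn yx _; rewrite yn.
  have n0 : (0 < n)%N by lia.
  have hn : vertex n \in U by have := chordU 0%N n0; rewrite (m0 n0); apply; case: ifP; lia.
  have hyn : vertex n - vertex y.+1 \in U.
    by apply: vertexB_mem => // t ty; apply: edgeU; [lia|case: ifP; lia].
  have hy : vertex y \in U.
    rewrite -[vertex y]subr0 -vertex0; apply: vertexB_mem => // t tx.
    by apply: edgeU; [lia|case: ifP; lia].
  have -> : vertex y.+1 - vertex y = vertex n - (vertex n - vertex y.+1) - vertex y.
    by rewrite opprB addrCA subrr addr0.
  by apply: memvB => //; apply: memvB.
Qed.

Lemma pred_edge_notin :
  c y \notin cspan c (cyclic_between y (cyclic_rank y x)).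
Proof.
have yN := ltn_ord y; have xN := ltn_ord x.
(* The cut isolates vertex [y] when [y] is small, and separates the vertices from [m (y - n)]
   upwards when [y] is large. Column [y] crosses it; no column strictly between [y] and [x] does. *)
pose p k := if (y < n)%N then k == y :> nat else (m (y - n) <= k)%N.
have mn a : (a < n)%N -> (0 < m a <= n)%N by move=> an; have := dm.2 a an; lia.
have memc k : (c k \in cut p) =
    (if (k < n)%N then p k.+1 == p k else p (m (k - n)%N) == p 0%N).
  have kN := ltn_ord k; rewrite mem_col_dyck_mx; case: ifP => kn.
    by rewrite mem_cut // ltnW.
  rewrite -[vertex _]subr0 -vertex0 mem_cut //.
  by have := mn (k - n)%N; lia.
have yc : c y \notin cut p.
  rewrite memc /p; case: (ltnP y n) => yn; first by rewrite eqxx (gtn_eqF (ltnSn y)).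
  by have := mn (y - n)%N; lia.
apply: contra yc; apply/subvP/cspanP=> k; rewrite inE memc => hk.
have kN := ltn_ord k; move: hk; rewrite !cyclic_rankE /p.
have mk := mn (k - n)%N.
have mono := dm.1.
case: xy => [][].
- by move=> ny xy1 _ mxy; repeat case: ifP => ?; lia.
- move=> ny xn mxy mlt; have := mlt (k - n)%N.
  by repeat case: ifP => ?; lia.
- move=> yn nx mxy mlt; have := mlt (k - n)%N; have := mn (x - n)%N.
  by rewrite yn; repeat case: ifP => ?; lia.
- move=> yn yx mne; have := mne (k - n)%N.
  by rewrite yn; repeat case: ifP => ?; lia.
Qed.

Lemma necklace_step (M : matroid 'I_(n + n)) (I : 'I_(n + n) -> {set 'I_(n + n)}) :
  represented_by M (dyck_mx m) -> Grassmann_necklace M I ->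
  [/\ y \in I y, x \notin I y & I (ordS y) = x |: (I y :\ y)].
Proof.
move=> MB nI; have IE i : I i = greedy c (cyclic_rank i).
  exact/(lex_min_greedy MB (dyck_mx_full m) i).
by rewrite !IE; apply: greedy_step; [exact: pred_edge_mem|exact: pred_edge_notin].
Qed.

End Step.

Lemma exists_necklace m (M : matroid 'I_(n + n)) :
  represented_by M (dyck_mx m) -> exists I, Grassmann_necklace M I.
Proof.
move=> MB; eexists => i; exact/(lex_min_greedy MB (dyck_mx_full m) i).
Qed.

End DyckMatrix.

(** * Cycles and height functions *)

Local Close Scope ring_scope.

(* [pos k] is the position of k in a cycle that lists 0, ..., n-1 upwards and *)
(* n, ..., 2n-1 downwards, with n + a placed after exactly m a small elements. *)
Definition dyck_positions (n : nat) (m pos : nat -> nat) : Prop :=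
  [/\ forall x y, (x < y < n)%N -> (pos x < pos y)%N,
      forall x y, (n <= x < y)%N -> (y < n + n)%N -> (pos y < pos x)%N
    & forall x y, (x < n <= y)%N -> (y < n + n)%N ->
        (pos x < pos y)%N = (x < m (y - n))%N].

(** No element lies between [x] and [y] in the cycle. If a clause of [pred_edge] failed, it would
    supply such an element. *)
Lemma dyck_positions_adjacent n m pos x y :
  dyck n m -> dyck_positions n m pos ->
  (forall z, (z < n + n)%N -> (pos z < n + n)%N) ->
  (forall u v, (u < n + n)%N -> (v < n + n)%N -> pos u = pos v -> u = v) ->
  (x < n + n)%N -> (y < n + n)%N ->
  (pos y = (pos x).+1 \/ pos y = 0 /\ pos x = (n + n).-1)%N ->
  pred_edge n m x y.
Proof.
move=> [mono bnd] [S L C] posN inj xN yN adj.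
have [ny|yn] := leqP n y.
  have an : (y - n < n)%N by lia.
  have By := bnd _ an.
  have p0 : (pos 0 < pos y)%N by rewrite C //; lia.
  have xy : (pos x).+1 = pos y by lia.
  have [nx|xn] := leqP n x.
    have yx : (y < x)%N.
      rewrite ltnNge leq_eqVlt; apply/negP=> /orP[/eqP e|h]; first by rewrite e in xy; lia.
      by have := L x y; lia.
    have exy : x = y.+1.
      have [//|ne] := eqVneq x y.+1.
      have := L y y.+1; have := L y.+1 x; lia.
    constructor 1; split=> //; apply/eqP; rewrite eqn_leq mono; last by lia.
    rewrite leqNgt; apply/negP=> mlt.
    (* The small element [m (x - n)] comes after [x], and would come before [y]. *)
    have sn : (m (x - n) < n)%N by lia.
    have := C (m (x - n)) x; have := C (m (x - n)) y.
    have := inj (m (x - n)) x; lia.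
  constructor 2; have xm : (x < m (y - n))%N by rewrite -C; lia.
  split=> //.
    apply/eqP; rewrite eqn_leq xm andbT leqNgt; apply/negP=> h.
    by have := S x x.+1; have := C x.+1 y; lia.
  move=> b hb; have := L y (n + b)%N; have := C x (n + b)%N.
  have -> : (n + b - n = b)%N by lia.
  have := inj x (n + b)%N; lia.
(* The wrap-around: the first element is 0 and the last one is [n], which is the exceptional
   alternative in the third clause of [pred_edge]. *)
have [p0|p0] := posnP (pos y).
  have y0 : y = 0%N by have := S 0%N y; lia.
  have ex : pos x = (n + n).-1 by lia.
  have nx : (n <= x)%N.
    rewrite leqNgt; apply/negP=> xn; have := C x n; have := posN n.
    have := bnd 0%N; rewrite subnn; lia.
  constructor 3; split=> //; first by lia.
    right; split=> //; apply/eqP; rewrite eqn_leq nx andbT leqNgt; apply/negP=> h.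
    by have := L n x; have := posN n; lia.
  move=> b hb; have := L (n + b)%N x; have := posN (n + b)%N; lia.
have xy : (pos x).+1 = pos y by lia.
have [nx|xn] := leqP n x.
  constructor 3; split=> //; first by lia.
    left; have h : (m (x - n) <= y)%N by rewrite leqNgt -C; lia.
    apply/eqP; rewrite eqn_leq h leqNgt; apply/negP=> h'.
    have := S (m (x - n)) y; have := C (m (x - n)) x; have := inj (m (x - n)) x; lia.
  move=> b hb; have := L (n + b)%N x; have := C y (n + b)%N.
  have -> : (n + b - n = b)%N by lia.
  have := inj y (n + b)%N; lia.
have xney : x <> y by move=> e; rewrite e in xy; lia.
constructor 4; split=> //.
  have := S x y; have := S y x; have := S x x.+1; have := S x.+1 y.
  have := inj x y; lia.
move=> b hb; apply/eqP=> e; have := C x (n + b)%N; have := C y (n + b)%N.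
have -> : (n + b - n = b)%N by lia.
have := inj y (n + b)%N.
have := S y x; have := inj x y; lia.
Qed.

Lemma sorted_filter_index (T : eqType) (e : rel T) (P : pred T) (s : seq T) x y :
  transitive e -> sorted e [seq z <- s | P z] -> x \in s -> y \in s ->
  P x -> P y -> (index x s < index y s)%N -> e x y.
Proof.
move=> etr; elim: s => //= z s IH srt xs ys Px Py.
have [zx|zx] := eqVneq z x.
  have [//|zy _] := eqVneq z y.
  move: ys srt; rewrite inE eq_sym (negbTE zy) zx Px /= => ys.
  rewrite (path_sortedE etr) => /andP[/allP h _].
  by apply: h; rewrite mem_filter Py.
have [//|zy] := eqVneq z y; rewrite ltnS.
move: xs ys; rewrite !inE ![_ == z]eq_sym (negbTE zx) (negbTE zy) => xs ys.
by apply: IH => //; move: srt; case: ifP => // _ /path_sorted.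
Qed.

Lemma prev_adjacent (T : eqType) (c : seq T) (y : T) :
  uniq c -> y \in c ->
  (index y c = (index (prev c y) c).+1 \/
   index y c = 0 /\ index (prev c y) c = (size c).-1)%N.
Proof.
case: c => // z q uc yc; rewrite prev_nth yc; set c := z :: q in uc yc *.
have nthc i : i < size c -> index (nth z c i) c = i.
  by move=> ic; rewrite index_uniq.
have [ezy|yz] := eqVneq z y.
  right; rewrite -ezy /= eqxx; split=> //.
  have zq : index z q = size q by apply/memNindex; case/andP: uc.
  rewrite zq; exact: (nthc (size q)).
left; rewrite {1}/c /= (negbTE yz); congr _.+1.
have yq : y \in q by move: yc; rewrite inE eq_sym (negbTE yz).
by symmetry; apply: nthc; rewrite /= ltnS index_size.
Qed.

Lemma eq_filter_iota (s : seq nat) (P : pred nat) (k : nat) :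
  uniq s -> sorted ltn [seq x <- s | P x] ->
  (forall x, (x < k) = P x && (x \in s)) -> [seq x <- s | P x] = iota 0 k.
Proof.
move=> us ss h; apply: (irr_sorted_eq ltn_trans ltnn ss (iota_ltn_sorted 0 k)).
by move=> x; rewrite mem_filter mem_iota h.
Qed.

Section CycleToDyck.
Variables (n : nat) (c : seq 'I_(n + n)).
Hypotheses (sc : size c = n + n) (uc : uniq c).
Hypothesis ord_c : small_increasing_large_decreasing c.
Let s := map val c.

Definition cycle_pos k := index k (map val c).

Definition cycle_heights a :=
  count (fun k => k < n) (take (index (n + a) (map val c)) (map val c)).

Lemma mem_full_cycle x : x \in c.
Proof.
have [|_ ->] := @uniq_min_size _ c (enum 'I_(n + n)) uc (fun x _ => mem_enum _ x).
  by rewrite -cardE card_ord sc.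
by rewrite mem_enum.
Qed.

Lemma mem_full_cycle_val k : (k \in s) = (k < n + n).
Proof.
rewrite /s; apply/idP/idP => [/mapP[x _ ->]|kN]; first exact: ltn_ord.
by apply/mapP; exists (Ordinal kN) => //; exact: mem_full_cycle.
Qed.

Let us : uniq s. Proof. by rewrite (map_inj_uniq val_inj). Qed.

Lemma cycle_pos_inj u v : u < n + n -> v < n + n ->
  cycle_pos u = cycle_pos v -> u = v.
Proof.
rewrite -!mem_full_cycle_val /cycle_pos => us_ vs_ e.
by rewrite -(nth_index 0 us_) -(nth_index 0 vs_) -/s e.
Qed.

Lemma cycle_pos_lt z : z < n + n -> cycle_pos z < n + n.
Proof. by rewrite -mem_full_cycle_val -index_mem size_map sc. Qed.

Let posS x y : x < y < n -> cycle_pos x < cycle_pos y.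
Proof.
move=> xy; rewrite ltnNge leq_eqVlt; apply/negP=> /orP[/eqP/cycle_pos_inj|h].
  by lia.
suff : y < x by lia.
apply: (sorted_filter_index ltn_trans ord_c.1) h; rewrite ?mem_full_cycle_val; lia.
Qed.

Let posL x y : n <= x < y -> y < n + n -> cycle_pos y < cycle_pos x.
Proof.
move=> xy yN; rewrite ltnNge leq_eqVlt; apply/negP=> /orP[/eqP/cycle_pos_inj|h].
  by lia.
suff : gtn x y by rewrite /=; lia.
apply: (sorted_filter_index _ ord_c.2) h; rewrite ?mem_full_cycle_val; try lia.
by move=> u v w /= h1 h2; exact: ltn_trans h1.
Qed.

Let small_all : [seq x <- s | x < n] = iota 0 n.
Proof.
by apply: (eq_filter_iota us ord_c.1) => x; rewrite mem_full_cycle_val; lia.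
Qed.

Let small_prefix i :
  [seq x <- take i s | x < n] = iota 0 (count (fun k => k < n) (take i s)).
Proof.
have h : [seq x <- take i s | x < n] ++ [seq x <- drop i s | x < n] = iota 0 n.
  by rewrite -filter_cat cat_take_drop small_all.
rewrite -size_filter.
have := congr1 (take (size [seq x <- take i s | x < n])) h.
rewrite take_size_cat // take_iota => {1}->; congr iota.
have := congr1 size h; rewrite size_cat size_iota; lia.
Qed.

(** By [small_prefix] the small elements before [y] are 0, 1, ... without gaps, so their number
    decides which ones they are. *)
Lemma cycle_dyck_positions : dyck_positions n cycle_heights cycle_pos.
Proof.
split=> [x y|x y|x y xy yN]; [exact: posS|exact: posL|].
have yn : n + (y - n) = y by lia.
rewrite /cycle_heights yn -/s.
have := mem_filter (fun k => k < n) x (take (index y s) s).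
rewrite small_prefix mem_iota /= add0n => ->.
rewrite in_take ?mem_full_cycle_val; last by lia.
by rewrite /cycle_pos -/s; lia.
Qed.

Lemma cycle_heights_dyck : 0 < n -> prefixes_dominated c ->
  index 0 s = 0 -> dyck n cycle_heights.
Proof.
move=> n0 dom h0; split=> [a b|a an].
  rewrite leq_eqVlt andb_orl => /orP[/andP[/eqP-> //]|ab].
  rewrite /cycle_heights -/s; apply: leq_count_subseq.
  have := @posL (n + a) (n + b); rewrite /cycle_pos -/s => h.
  have hle : index (n + b) s <= index (n + a) s by apply: ltnW; apply: h; lia.
  by rewrite -(subnKC hle) takeD prefix_subseq.
have naN : n + a < n + n by lia.
rewrite /cycle_heights -/s; set i := index (n + a) s.
apply/andP; split; last first.
  rewrite -[leqRHS](size_iota 0 n) -small_all size_filter.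
  by apply: leq_count_subseq; exact: take_subseq.
have iN : i < n + n by have := cycle_pos_lt naN.
have i0 : 0 < i.
  rewrite lt0n; apply/eqP=> e.
  have /cycle_pos_inj : cycle_pos (n + a) = cycle_pos 0 by rewrite /cycle_pos h0.
  by lia.
have iS : take i.+1 s = rcons (take i s) (n + a).
  rewrite (take_nth 0) ?nth_index ?mem_full_cycle_val //.
  by rewrite size_map sc.
have := dom i; rewrite -!(count_map val (fun k => k < n)).
rewrite -!(count_map val (fun k => n <= k)) !map_take -/s iS -cats1 !count_cat /=.
have -> : (n + a < n) = false by lia.
rewrite -(count_cat _ _ [:: n + a]) !addn0 cats1 -iS => domi.
(* The large elements descend, so the prefix that ends with [n + a] contains all of n + a, ..., 2n -
   1; domination then gives as many small ones. *)
have cl : n - a <= count (fun k => n <= k) (take i.+1 s).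
  rewrite -[leqLHS](size_iota (n + a)) -size_filter.
  apply: uniq_leq_size; first exact: iota_uniq.
  move=> k; rewrite mem_iota mem_filter => hk.
  rewrite in_take ?mem_full_cycle_val ?ltnS; last by lia.
  apply/andP; split; first by lia.
  have [->//|kna] := eqVneq k (n + a).
  by apply/ltnW/posL; lia.
by apply: leq_trans cl (domi _); lia.
Qed.

Lemma cycle_pred_edge y : 0 < n -> prefixes_dominated c -> index 0 s = 0 ->
  pred_edge n cycle_heights (prev c y) y.
Proof.
move=> n0 dom h0.
apply: (dyck_positions_adjacent (cycle_heights_dyck n0 dom h0) cycle_dyck_positions).
- exact: cycle_pos_lt.
- exact: cycle_pos_inj.
- exact: ltn_ord.
- exact: ltn_ord.
by have := prev_adjacent uc (mem_full_cycle y); rewrite /cycle_pos !(index_map val_inj) sc.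
Qed.

End CycleToDyck.

Section DyckToCycle.
Variables (n : nat) (m : nat -> nat).
Hypotheses (n0 : 0 < n) (dm : dyck n m).

(* Lexicographic: small t at level 2t + 1, large n + a at level 2 m a, the     *)
(* large ones of one level downwards.                                         *)
Let key k := if k < n then k.*2.+1 * (n + n)
  else (m (k - n)).*2 * (n + n) + (n + n).-1 - k.
Let N := n + n.
Definition dyck_cycle : seq 'I_(n + n) :=
  sort (fun x y : 'I_(n + n) => key x <= key y) (enum 'I_(n + n)).

Let keyS x y : x < y < n -> key x < key y.
Proof. by rewrite /key => xy; do 2 case: ifP; nia. Qed.

Let keyL x y : n <= x < y -> y < n + n -> key y < key x.
Proof.
rewrite /key => xy yN; do 2 (case: ifP; try lia); move=> _ _.
have : m (y - n) <= m (x - n) by apply: dm.1; lia.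
nia.
Qed.

Let keyC x y : x < n <= y -> y < n + n -> (key x < key y) = (x < m (y - n)).
Proof.
rewrite /key => xy yN; do 2 (case: ifP; try lia); move=> _ _.
by case: ltnP => h; nia.
Qed.

Let key_inj x y : x < n + n -> y < n + n -> key x = key y -> x = y.
Proof.
move=> xN yN e; have := keyS (x := x) (y := y); have := keyS (x := y) (y := x).
have := keyL (x := x) (y := y); have := keyL (x := y) (y := x).
have ne u v : u < n <= v -> v < n + n -> key u != key v.
  rewrite /key => xy yN'; do 2 (case: ifP; try lia); move=> _ _.
  by case: (ltnP u (m (v - n))) => h; nia.
have := ne x y; have := ne y x; rewrite e eqxx; lia.
Qed.

Lemma size_dyck_cycle : size dyck_cycle = n + n.
Proof. by rewrite size_sort size_enum_ord. Qed.

Lemma dyck_cycle_uniq : uniq dyck_cycle.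
Proof. by rewrite sort_uniq enum_uniq. Qed.

Let mem_dc x : x \in dyck_cycle. Proof. by rewrite mem_sort mem_enum. Qed.

Let sorted_dc : sorted (fun x y : 'I_(n + n) => key x < key y) dyck_cycle.
Proof.
rewrite -(@sorted_map _ _ (fun x : 'I_(n + n) => key x) ltn) ltn_sorted_uniq_leq.
rewrite sorted_map map_inj_uniq ?dyck_cycle_uniq /=; last first.
  by move=> x y /key_inj e; apply: ord_inj; apply: e.
by apply: sort_sorted => x y; exact: leq_total.
Qed.

Lemma dyck_cycle_index (x y : 'I_(n + n)) :
  (index x dyck_cycle < index y dyck_cycle) = (key x < key y).
Proof.
have tr : transitive (fun x y : 'I_(n + n) => key x < key y).
  by move=> u v w; exact: ltn_trans.
have lt u v := sorted_ltn_index tr sorted_dc u v (mem_dc u) (mem_dc v).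
apply/idP/idP; first exact: lt.
move=> h; rewrite ltnNge leq_eqVlt; apply/negP=> /orP[/eqP e|h']; last by have := lt _ _ h'; lia.
have e' : y = x by rewrite -(nth_index x (mem_dc x)) -e nth_index.
by move: h; rewrite e' ltnn.
Qed.

Lemma dyck_cycle_ord : small_increasing_large_decreasing dyck_cycle.
Proof.
split; rewrite filter_map sorted_map.
  apply: (@sub_in_sorted _ (fun x : 'I_(n + n) => x < n)
    (fun x y : 'I_(n + n) => key x < key y)).
  - move=> x y xn yn /= kxy; have {}xn : x < n := xn; have {}yn : y < n := yn.
    have := keyS (x := y) (y := x).
    have ne : x <> y :> nat by move=> e; move: kxy; rewrite e ltnn.
    lia.
  - by apply/allP=> x; rewrite mem_filter => /andP[].
  - by apply: sorted_filter sorted_dc => u v w; exact: ltn_trans.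
apply: (@sub_in_sorted _ (fun x : 'I_(n + n) => n <= x)
  (fun x y : 'I_(n + n) => key x < key y)).
- move=> x y xn yn /= kxy; have {}xn : n <= x := xn; have {}yn : n <= y := yn.
  have := keyL (x := x) (y := y).
  have ne : x <> y :> nat by move=> e; move: kxy; rewrite e ltnn.
  by have := ltn_ord x; have := ltn_ord y; lia.
- by apply/allP=> x; rewrite mem_filter => /andP[].
- by apply: sorted_filter sorted_dc => u v w; exact: ltn_trans.
Qed.

Local Notation pos := (cycle_pos dyck_cycle).

Lemma dyck_cycle_positions : dyck_positions n m pos.
Proof.
have posE x y : x < N -> y < N -> (pos x < pos y) = (key x < key y).
  move=> xN yN; rewrite -[x]/(val (Ordinal xN)) -[y]/(val (Ordinal yN)).
  by rewrite /cycle_pos !(index_map val_inj) dyck_cycle_index.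
split=> [x y xy|x y xy yN|x y xy yN]; rewrite posE /N //; try lia.
- exact: keyS.
- exact: keyL.
- exact: keyC.
Qed.

Lemma dyck_cycle_pred_edge y : pred_edge n m (prev dyck_cycle y) y.
Proof.
apply: (dyck_positions_adjacent dm dyck_cycle_positions).
- exact: cycle_pos_lt size_dyck_cycle dyck_cycle_uniq.
- exact: cycle_pos_inj size_dyck_cycle dyck_cycle_uniq.
- exact: ltn_ord.
- exact: ltn_ord.
have := prev_adjacent dyck_cycle_uniq (mem_dc y).
by rewrite /cycle_pos !(index_map val_inj) size_dyck_cycle.
Qed.

Lemma dyck_cycle_head : exists (one : 'I_(n + n)) js,
  one = 0 :> nat /\ dyck_cycle = one :: js.
Proof.
have N0 : 0 < n + n by lia.
have := dyck_cycle_index (Ordinal N0); have := mem_dc (Ordinal N0).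
case: dyck_cycle => // z js _ h; exists z, js; split=> //.
have := h z; rewrite /= eqxx ltn0 => /esym.
have [//|z0] := posnP z.
suff -> : key 0 < key z by [].
rewrite /key n0; case: (ltnP z n) => zn; first by nia.
have zN := ltn_ord z; have mz : 0 < m (z - n) by have := dm.2 (z - n); lia.
have h2 : n + n <= m (z - n) * (n + n) by exact: leq_pmull.
lia.
Qed.

(** Let [z] be the least large element of the prefix. The large ones there number at most 2n - z,
    which is at most [m (z - n)], and the small elements below [m (z - n)] all precede [z]. *)
Lemma dyck_cycle_dominated : prefixes_dominated dyck_cycle.
Proof.
move=> k _; set s := map val dyck_cycle.
have us : uniq s by rewrite (map_inj_uniq val_inj) dyck_cycle_uniq.
have mem_val := mem_full_cycle_val size_dyck_cycle dyck_cycle_uniq.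
rewrite -(count_map val (fun x => n <= x)) -(count_map val (fun x => x < n)).
rewrite !map_take -/s; set T := take k.+1 s.
have uT : uniq T by exact: take_uniq.
have memT x : x < n + n -> (x \in T) = (pos x <= k).
  by move=> xN; rewrite in_take ?mem_val // ltnS.
have [|] := boolP (has (fun x => n <= x) T); last first.
  by rewrite has_count -leqNgt leqn0 => /eqP->.
case/hasP=> z0 z0T z0n.
have ex : exists z, (n <= z) && (z \in T) by exists z0; rewrite z0n.
case: (ex_minnP ex) => z /andP[nz zT] zmin.
have zN : z < n + n by rewrite -mem_val; exact: mem_take zT.
apply: (@leq_trans (n + n - z)).
  rewrite -[leqRHS](size_iota z) -size_filter; apply: uniq_leq_size.
    exact: filter_uniq.
  move=> x; rewrite mem_filter mem_iota => /andP[nx xT].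
  have := zmin x; rewrite nx xT => /(_ isT).
  have : x < n + n by rewrite -mem_val; exact: mem_take xT.
  lia.
apply: (@leq_trans (m (z - n))); first by have := dm.2 (z - n); lia.
rewrite -[leqLHS](size_iota 0) -size_filter; apply: uniq_leq_size.
  exact: iota_uniq.
move=> x; rewrite mem_filter mem_iota add0n => xm.
have xn : x < n by have := dm.2 (z - n); lia.
rewrite xn memT /=; last by lia.
have [_ _ C] := dyck_cycle_positions.
by have := C x z; move: zT; rewrite memT //; lia.
Qed.

End DyckToCycle.

(** * Unit interval orders *)

Local Open Scope ring_scope.

Lemma altitudeE (d : Order.disp_t) (P : finPOrderType d) (x : P) :
  altitude x = #|[set y : P | (y < x)%O]|%:Z - #|[set y : P | (x < y)%O]|%:Z.
Proof.
rewrite /altitude.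
have -> : [set y : P | (y <= x)%O] = x |: [set y : P | (y < x)%O].
  by apply/setP=> y; rewrite !inE le_eqVlt.
have -> : [set y : P | (x <= y)%O] = x |: [set y : P | (x < y)%O].
  by apply/setP=> y; rewrite !inE le_eqVlt eq_sym.
rewrite !cardsU1 !inE ltxx /=; lia.
Qed.

Lemma card_ord_ltn n t : (t <= n)%N -> #|[set k : 'I_n | (k < t)%N]| = t.
Proof.
move=> tn; rewrite -sum1_card (eq_bigl (fun k : 'I_n => k < t)%N); last first.
  by move=> k; rewrite inE.
by rewrite -(big_ord_widen _ (fun=> 1%N) tn) sum1_card card_ord.
Qed.

Lemma down_closed_ord n (S : {set 'I_n}) (i : 'I_n) :
  (forall j k : 'I_n, (j <= k)%N -> k \in S -> j \in S) ->
  (i \in S) = (i < #|S|)%N.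
Proof.
move=> dS; have iN := ltn_ord i; apply/idP/idP => [iS|].
  rewrite -[X in (X <= _)%N](@card_ord_ltn n i.+1) //.
  by apply/subset_leq_card/subsetP=> k; rewrite inE ltnS => ki; exact: dS iS.
apply: contraTT => iS; rewrite -leqNgt.
apply: (@leq_trans #|[set k : 'I_n | (k < i)%N]|); last first.
  by rewrite card_ord_ltn // ltnW.
apply/subset_leq_card/subsetP=> k kS; rewrite inE ltnNge.
by apply: contra iS => ik; exact: dS kS.
Qed.

Section Canonical.
Variables (R : realType) (d : Order.disp_t) (P : finPOrderType d) (n : nat).
Variable e : 'I_n -> P.

Lemma psi_dyck_mx (m : nat -> nat) :
  (forall i j : 'I_n, (e i < e j)%O = (i < n - m j)%N) ->
  psi (antiadjacency R e) = dyck_mx R n m.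
Proof.
move=> h; congr row_mx; apply/matrixP=> i j; rewrite !mxE h /=.
have iN := ltn_ord i; congr (_ * _); case: ifP => ?; case: ltnP => //; lia.
Qed.

Hypotheses (uP : unit_interval_order R P) (ce : canonical_labeling e).

(** If the labels disagree with the order of the endpoints, the strict down-sets and up-sets are
    nested in the direction that makes the altitude of [e j] at most that of [e i]. Canonicity gives
    the reverse inequality, so both inclusions are equalities. *)
Lemma canonical_mono (i j : 'I_n) : (i <= j)%N ->
  (forall x, (x < e i)%O -> (x < e j)%O) /\ (forall x, (e j < x)%O -> (e i < x)%O).
Proof.
move=> ij; have [q [qi qE]] := uP; have [_ can] := ce.
have [qij|qji] := leP (q (e i)) (q (e j)).
  by split=> x; rewrite !qE; lra.
have s1 : [set y | (y < e j)%O] \subset [set y | (y < e i)%O].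
  by apply/subsetP=> y; rewrite !inE !qE; lra.
have s2 : [set y | (e i < y)%O] \subset [set y | (e j < y)%O].
  by apply/subsetP=> y; rewrite !inE !qE; lra.
have h : altitude (e i) <= altitude (e j).
  by rewrite leNgt; apply/negP=> /can; rewrite ltnNge ij.
have cE (a1 a2 a3 a4 : nat) : a3%:Z - a4%:Z <= a1%:Z - a2%:Z ->
  (a1 <= a3)%N -> (a4 <= a2)%N -> (a3 <= a1)%N /\ (a2 <= a4)%N.
  by clear; lia.
rewrite !altitudeE in h.
have c1 := subset_leq_card s1; have c2 := subset_leq_card s2.
have e1 : [set y | (y < e j)%O] = [set y | (y < e i)%O].
  apply/eqP; rewrite eqEcard s1 /=; exact: (cE _ _ _ _ h c1 c2).1.
have e2 : [set y | (e i < y)%O] = [set y | (e j < y)%O].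
  apply/eqP; rewrite eqEcard s2 /=; exact: (cE _ _ _ _ h c1 c2).2.
split=> x; first by move/setP/(_ x): e1; rewrite !inE => ->.
by move/setP/(_ x): e2; rewrite !inE => ->.
Qed.

(** By [canonical_mono] the elements below [e j] carry an initial segment of labels; it excludes
    [j], whence the bound n - j. *)
Lemma canonical_dyck :
  exists m, dyck n m /\ psi (antiadjacency R e) = dyck_mx R n m.
Proof.
pose S j := [set i : 'I_n | (e i < e j)%O].
pose m a := oapp (fun j : 'I_n => n - #|S j|)%N 0%N (insub a).
have mE (j : 'I_n) : m j = (n - #|S j|)%N by rewrite /m valK.
have SE (i j : 'I_n) : (i \in S j) = (i < #|S j|)%N.
  apply: down_closed_ord => k l kl; rewrite !inE => h.
  exact: (canonical_mono kl).2.
have Sle (j : 'I_n) : (#|S j| <= j)%N.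
  by rewrite leqNgt -SE inE ltxx.
exists m; split; last first.
  apply: psi_dyck_mx => i j; rewrite mE subKn.
    by rewrite -SE inE.
  by apply: leq_trans (Sle j) (ltnW (ltn_ord j)).
split=> [a b /andP[ab bn]|a an]; last first.
  by rewrite (mE (Ordinal an)); have /= := Sle (Ordinal an); lia.
have an := leq_ltn_trans ab bn.
rewrite (mE (Ordinal an)) (mE (Ordinal bn)); apply: leq_sub2l.
apply/subset_leq_card/subsetP=> k; rewrite !inE.
exact: (@canonical_mono (Ordinal an) (Ordinal bn) ab).1.
Qed.

End Canonical.

Lemma exists_between (R : realType) (s t : seq R) :
  {in s & t, forall x y, x < y} ->
  exists z, {in s, forall x, x < z} /\ {in t, forall y, z < y}.
Proof.
have above x (t' : seq R) : {in t', forall y, x < y} ->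
    exists2 z, x < z & {in t', forall y, z < y}.
  elim: t' => [|y t' IH] h; first by exists (x + 1) => //; lra.
  have [|z xz zt] := IH; first by move=> u ut; apply: h; rewrite inE ut orbT.
  have xy : x < y by apply: h; rewrite mem_head.
  exists (Num.min z ((x + y) / 2)); first by rewrite lt_min xz /=; lra.
  move=> u; rewrite inE gt_min => /orP[/eqP->|/zt ->//].
  by apply/orP; right; lra.
elim: s => [|x s IH] h.
  elim: t {h} => [|y t [z [_ zt]]]; first by exists 0.
  exists (Num.min z (y - 1)); split=> // u; rewrite inE gt_min.
  by move=> /orP[/eqP->|/zt ->//]; apply/orP; right; lra.
have [|z [zs zt]] := IH; first by move=> u v us; apply: h; rewrite inE us orbT.
have [xz|zx] := ltP x z.
  by exists z; split=> // u; rewrite inE => /orP[/eqP->|/zs].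
have [|w xw wt] := above x t; first by move=> u; apply: h; rewrite mem_head.
exists w; split=> // u; rewrite inE => /orP[/eqP->//|/zs uz].
by apply: lt_trans (le_lt_trans zx xw).
Qed.

(* The strict upper bounds keep the construction extendable at every step.    *)
Lemma dyck_intervals (R : realType) (n : nat) (m : nat -> nat) (k : nat) :
  dyck n m -> (k <= n)%N ->
  exists q : nat -> R,
    (forall i j, (i < j < k)%N -> q i < q j) /\
    (forall i j, (i < k)%N -> (j < k)%N ->
       if (i < n - m j)%N then q i + 1 < q j else q j < q i + 1).
Proof.
move=> [mono bnd]; elim: k => [|k IH] kn; first by exists (fun=> 0); split=> //; lia.
have [q [qS qE]] := IH (ltnW kn).
(* The new endpoint [z] must lie above [s], to be greater than all earlier endpoints and to follow
   the prescribed intervals, and below [t], to overlap the others. *)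
pose s := [seq q i + 1 | i <- iota 0 k & (i < n - m k)%N] ++ [seq q i | i <- iota 0 k].
pose t := [seq q i + 1 | i <- iota 0 k & (n - m k <= i)%N].
have [|z [zs zt]] := @exists_between R s t.
  move=> x y; rewrite mem_cat => xs /mapP[j]; rewrite mem_filter mem_iota => hj ->.
  case/orP: xs => /mapP[i]; rewrite ?mem_filter mem_iota => hi ->.
    by rewrite ltrD2r; apply: qS; lia.
  (* As [m] is weakly decreasing, j >= n - m k gives j >= n - m i, so the invariant already yields q
     i < q j + 1. *)
  have := qE j i; have := mono i k; case: ifP => h; first by lia.
  by move=> _; apply; lia.
have zl i : (i < k)%N -> q i < z.
  by move=> ik; apply: zs; rewrite mem_cat map_f ?orbT // mem_iota.
have zg i : (i < k)%N -> if (i < n - m k)%N then q i + 1 < z else z < q i + 1.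
  move=> ik; case: ifP => h.
    apply: zs; rewrite mem_cat; apply/orP; left; apply: (map_f (fun i => q i + 1)).
    by rewrite mem_filter mem_iota h.
  apply: zt; apply: (map_f (fun i => q i + 1)); rewrite mem_filter mem_iota; lia.
exists (fun i => if i == k then z else q i); split=> [i j ij|i j ik jk].
  have -> : (i == k) = false by lia.
  by case: eqP => jk; [apply: zl|apply: qS]; lia.
have := bnd j; have := bnd k kn; move=> bk bj.
case: (i =P k) => [->|ik']; case: (j =P k) => [ej|jk'].
- have -> : (k < n - m j)%N = false by rewrite ej; lia.
  lra.
- have -> : (k < n - m j)%N = false by lia.
  by apply: (lt_trans (zl j _)); [lia|lra].
- by rewrite ej; apply: zg; lia.
- by apply: qE; lia.
Qed.

(** An alias of ['I_n] that records [q], so that an order depending on [q] can be attached to it. *)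
Definition interval_order (R : realType) (n : nat) (q : 'I_n -> R) := 'I_n.

Section IntervalOrder.
Variables (R : realType) (n : nat) (q : 'I_n -> R).
Local Notation T := (interval_order q).

HB.instance Definition _ := Finite.on T.

Definition interval_lt (x y : T) := q x + 1 < q y.

Lemma interval_lt_irr : irreflexive interval_lt.
Proof. by move=> x; rewrite /interval_lt; lra. Qed.

Lemma interval_lt_trans : transitive interval_lt.
Proof. by move=> y x z; rewrite /interval_lt; lra. Qed.

HB.instance Definition _ := Order.Lt_isPOrder.Build (Order.Disp tt tt) T
  interval_lt_irr interval_lt_trans.

End IntervalOrder.

Section UnitIntervalPositroid.
Variables (R : realType) (n : nat).

(** The endpoints increase with the index, so altitudes weakly increase and the identity labeling is
    canonical. *)
Lemma dyck_unit_interval_positroid m (M : matroid 'I_(n + n)) :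
  dyck n m -> represented_by M (dyck_mx R n m) -> unit_interval_positroid R M.
Proof.
move=> dm MB; have [q [qS qE]] := dyck_intervals R dm (leqnn n).
pose q' (i : 'I_n) := q i.
have q'S (i j : 'I_n) : (i < j)%N -> q' i < q' j.
  by move=> ij; apply: qS; rewrite ij ltn_ord.
have q'le (i j : 'I_n) : (i <= j)%N -> q' i <= q' j.
  rewrite leq_eqVlt => /orP[/eqP/ord_inj->//|/q'S/ltW//].
have q'inj : injective q'.
  move=> i j e; apply: ord_inj.
  by case: (ltngtP i j) => // /q'S; rewrite e ltxx.
pose P : finPOrderType (Order.Disp tt tt) := interval_order q'.
have ltE (x y : P) : (x < y)%O = (q' x + 1 < q' y) by [].
exists (Order.Disp tt tt), P, (fun i => i); split.
- by exists q'; split; [exact: q'inj|exact: ltE].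
- split=> [|i j]; first by exists (fun i => i).
  rewrite !altitudeE => h; rewrite ltnNge; apply/negP=> /q'le ji.
  have s1 : [set y : P | (y < (j : P))%O] \subset [set y : P | (y < (i : P))%O].
    by apply/subsetP=> y; rewrite !inE !ltE; lra.
  have s2 : [set y : P | ((i : P) < y)%O] \subset [set y : P | ((j : P) < y)%O].
    by apply/subsetP=> y; rewrite !inE !ltE; lra.
  by have := subset_leq_card s1; have := subset_leq_card s2; lia.
rewrite (@psi_dyck_mx _ _ P n (fun i => i) m) // => i j; rewrite ltE /q'.
have := qE i j (ltn_ord i) (ltn_ord j); case: ifP => // _ h.
by apply/negbTE; rewrite -leNgt; lra.
Qed.

Lemma unit_interval_positroidP (M : matroid 'I_(n + n)) :
  unit_interval_positroid R M <->
  exists m, dyck n m /\ represented_by M (dyck_mx R n m).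
Proof.
split=> [[d [P [e [uP ce MB]]]]|[m [dm MB]]].
  have [m [dm e_m]] := canonical_dyck uP ce.
  by exists m; split=> //; rewrite -e_m.
exact: dyck_unit_interval_positroid dm MB.
Qed.

End UnitIntervalPositroid.

(** * Counting *)

Local Close Scope ring_scope.

(** Height functions read from left to right: with [r] entries left and [u] the previous entry, the
    next one runs over r, ..., u. *)
Fixpoint dyck_seqs (r u : nat) : seq (seq nat) :=
  if r is r'.+1 then [seq x :: l | x <- iota r (u - r'), l <- dyck_seqs r' x]
  else [:: [::]].

Lemma dyck_seqs_uniq r u : uniq (dyck_seqs r u).
Proof.
elim: r u => //= r IH u; apply: allpairs_uniq_dep => //; first exact: iota_uniq.
by move=> [x l] [x' l'] _ _ /= [-> ->].
Qed.

Lemma mem_dyck_seqs r u l : (l \in dyck_seqs r u) =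
  [&& size l == r, path geq u l & all (fun i => r - i <= nth 0 l i) (iota 0 r)].
Proof.
elim: r u l => [|r IH] u [|x l] //=.
  by apply/allpairsPdep => -[y [l' [_ _ //]]].
rewrite eqSS -[1]addn0 iotaDl all_map.
transitivity ((r < x <= u) && (l \in dyck_seqs r x)); last first.
  rewrite IH subn0 -[all (preim _ _) _]/(all (fun i => r - i <= nth 0 l i) (iota 0 r)).
  by case: (x <= u); case: (r < x); case: (_ == r); case: (path _ _ _); case: (all _ _).
apply/allpairsPdep/andP => [[y [l' [yr l'd [-> ->]]]]|[xr ld]].
  by split=> //; move: yr; rewrite mem_iota; lia.
by exists x, l; split=> //; rewrite mem_iota; lia.
Qed.

Lemma size_dyck_seqsS r u : size (dyck_seqs r.+1 u) =
  sumn [seq size (dyck_seqs r x) | x <- iota r.+1 (u - r)].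
Proof. exact: size_allpairs_dep. Qed.

Lemma size_dyck_seqs_rec r u : r <= u ->
  size (dyck_seqs r.+1 u.+1) = size (dyck_seqs r.+1 u) + size (dyck_seqs r u.+1).
Proof.
move=> ru; rewrite !size_dyck_seqsS subSn // -[(u - r).+1]addn1 iotaD map_cat sumn_cat.
by rewrite /= addn0 addSn subnKC.
Qed.

(* The reflection principle, in additive form. *)
Lemma size_dyck_seqs r u : r <= u ->
  size (dyck_seqs r.+1 u) + 'C(u + r.+1, r) = 'C(u + r.+1, r.+1).
Proof.
elim: r u => [|r IHr].
  move=> u _; rewrite addn1 bin0 bin1 size_dyck_seqsS subn0 addn1.
  by congr _.+1; rewrite -[RHS](size_iota 1); elim: (iota 1 u) => //= x s ->.
elim=> [//|u IHu].
rewrite leq_eqVlt => /orP[/eqP ru|ru].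
  rewrite -ru /= subnn /= add0n -[RHS]bin_sub; last by lia.
  by congr 'C(_, _); lia.
rewrite size_dyck_seqs_rec //.
have := IHu ru; have := IHr u.+1 (ltnW (ltnW ru)).
have -> : u.+1 + r.+1 = u + r.+2 by lia.
by rewrite addSn !binS; lia.
Qed.

(** For n > 0 the binomial subtracted by reflection is n / (n + 1) times the central one. *)
Lemma size_dyck_seqs_diag n : n.+1 * size (dyck_seqs n n) = 'C(2 * n, n).
Proof.
case: n => [//|n].
have := mul_bin_left (n.+1 + n.+1) n; have := size_dyck_seqs (leqnSn n).
have -> : n.+1 + n.+1 - n = n.+2 by lia.
by rewrite mul2n -addnn; set T := size _; nia.
Qed.

Local Open Scope ring_scope.

Section Counting.
Variables (R : realType) (n : nat).

Definition heights_of (m : {ffun 'I_n -> 'I_n.+1}) (a : nat) : nat :=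
  oapp (fun j : 'I_n => m j : nat) 0%N (insub a).

Definition dyck_ffuns : {set {ffun 'I_n -> 'I_n.+1}} :=
  [set m | `[< dyck n (heights_of m) >]].

Lemma heights_ofE m (j : 'I_n) : heights_of m j = m j.
Proof. by rewrite /heights_of valK. Qed.

Lemma heights_of_ffun (m : nat -> nat) a : (forall b, (b < n)%N -> (m b <= n)%N) ->
  (a < n)%N -> heights_of [ffun b : 'I_n => inord (m b)] a = m a.
Proof.
move=> mn an; rewrite (heights_ofE _ (Ordinal an)) ffunE inordK //= ltnS.
exact: mn.
Qed.

Lemma card_dyck_ffuns : #|dyck_ffuns| = size (dyck_seqs n n).
Proof.
pose G (m : {ffun 'I_n -> 'I_n.+1}) := mkseq (heights_of m) n.
rewrite cardE -(size_map G); apply/perm_size/uniq_perm.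
- rewrite map_inj_uniq ?enum_uniq // => m m' e; apply/ffunP=> j; apply: ord_inj.
  by have := congr1 (nth 0%N ^~ j) e; rewrite /G !nth_mkseq // !heights_ofE.
- exact: dyck_seqs_uniq.
move=> l; rewrite mem_dyck_seqs; apply/mapP/and3P => [[m]|[/eqP sl lp la]].
  rewrite mem_enum inE => /asboolP[mono bnd] ->; split.
  - by rewrite size_mkseq.
  - apply/(pathP 0%N) => -[|i]; rewrite size_mkseq => iN /=.
      by rewrite nth_mkseq //; have := bnd 0%N iN; lia.
    by rewrite !nth_mkseq //; [apply: mono; lia|exact: ltnW].
  - apply/allP=> i; rewrite mem_iota add0n => iN.
    by rewrite nth_mkseq //; have := bnd i iN; lia.
have lbnd a : (a < n)%N -> (n - a <= nth 0 l a)%N.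
  by move=> an; apply: (allP la); rewrite mem_iota.
have gtr : transitive geq by move=> x y z /= h1 h2; exact: leq_trans h2 h1.
have lle a : (a < n)%N -> (nth 0 l a <= n)%N.
  move=> an; move: lp; rewrite (path_sortedE gtr) => /andP[/allP h _].
  by apply: h; rewrite mem_nth ?sl.
exists [ffun b : 'I_n => inord (nth 0%N l b)].
  rewrite mem_enum inE; apply/asboolP; split=> [a b /andP[ab bn]|a an].
    have an := leq_ltn_trans ab bn.
    rewrite !heights_of_ffun //.
    apply: (sorted_leq_nth gtr (fun x => leqnn x) 0%N (path_sorted lp)) => //;
      by rewrite inE sl.
  by rewrite heights_of_ffun // lbnd // lle.
apply: (@eq_from_nth _ 0%N); rewrite ?size_mkseq // => i; rewrite sl => iN.
by rewrite nth_mkseq // heights_of_ffun.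
Qed.

(** The small columns form the path 0, ..., n. Replacing its edge [i] by the chord 0 -- m j leaves a
    spanning tree iff the chord crosses the cut at [i]. These bases determine [m]. *)
Lemma dyck_mx_basis (m : nat -> nat) (i j : 'I_n) : (m j <= n)%N ->
  (rshift n j |: [set lshift n k | k in [set~ i]] \in mx_bases (dyck_mx R n m))
  = (i < m j)%N.
Proof.
move=> mj; set K := _ |: _; set c := fun k => col k (dyck_mx R n m).
have cK : #|K| = n.
  rewrite cardsU1 card_imset; last exact: lshift_inj.
  have -> : rshift n j \notin [set lshift n k | k in [set~ i]].
    by apply/imsetP=> -[k _ /eqP]; rewrite eq_rlshift.
  have := cardsC1 i; rewrite card_ord => ->; have := ltn_ord i; lia.
have edgeE (U : {vspace 'cV[R]_n}) (k : 'I_n) :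
    (col (lshift n k) (dyck_mx R n m) \in U) = (vertex R n k.+1 - vertex R n k \in U).
  by rewrite mem_col_dyck_mx /= ltn_ord.
have [im|mi] := ltnP.
  apply: cspan_basis => //; apply: (@lshift_cols_full R n m) => k.
  have edgeU (t : nat) : t != i -> (t < n)%N ->
      vertex R n t.+1 - vertex R n t \in cspan c K.
    move=> ti tn; rewrite -(edgeE _ (Ordinal tn)); apply: (@mem_cspan _ _ _ c).
    by rewrite inE imset_f ?orbT // !inE.
  have [->|ki] := eqVneq k i; last by rewrite edgeE edgeU.
  have mU : vertex R n (m j) \in cspan c K.
    by rewrite -(col_rshift_dyck_mx R m j); apply: (@mem_cspan _ _ _ c); rewrite setU11.
  have hi : vertex R n i - vertex R n 0 \in cspan c K.
    by apply: vertexB_mem => // t ti; apply: edgeU; have := ltn_ord i; lia.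
  have hm : vertex R n (m j) - vertex R n i.+1 \in cspan c K.
    by apply: vertexB_mem => // t ti; apply: edgeU; lia.
  rewrite edgeE.
  have -> : vertex R n i.+1 - vertex R n i = vertex R n (m j) -
      (vertex R n (m j) - vertex R n i.+1) - (vertex R n i - vertex R n 0).
    by rewrite vertex0 subr0 opprB addrCA subrr addr0.
  by apply: memvB => //; apply: memvB.
apply/negbTE/negP=> /basis_cspan full.
have : col (lshift n i) (dyck_mx R n m) \in cspan c K by rewrite full memvf.
rewrite edgeE => /(subvP _) hU.
have : vertex R n i.+1 - vertex R n i \in cut R n (fun k => i < k)%N.
  apply: hU; apply/cspanP=> k; rewrite !inE => /orP[/eqP->|/imsetP[l]].
    rewrite /c col_rshift_dyck_mx -[vertex _ _ _]subr0 -(vertex0 R n) mem_cut //.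
    by rewrite ltnNge mi.
  rewrite !inE => li ->; rewrite /c edgeE mem_cut //; last exact: ltnW.
  by have : l <> i :> nat by [move=> /ord_inj e; rewrite e eqxx in li]; lia.
rewrite mem_cut //; last exact: ltnW.
by rewrite ltnSn ltnn.
Qed.

Definition dyck_matroid (m : {ffun 'I_n -> 'I_n.+1}) : matroid 'I_(n + n) :=
  Matroid (mx_basis_family (dyck_mx_full R n (heights_of m))).

Lemma dyck_matroid_inj : injective dyck_matroid.
Proof.
move=> m m' /(congr1 (@bases _)) /= e; apply/ffunP=> j; apply: ord_inj.
have h (i : 'I_n) : (i < m j)%N = (i < m' j)%N.
  have := @dyck_mx_basis (heights_of m) i j.
  by rewrite e dyck_mx_basis heights_ofE ?heights_ofE -ltnS // => ->.
have [hlt|hlt|//] := ltngtP (m j : nat) (m' j).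
  have i_n : (m j < n)%N by apply: leq_trans hlt _; rewrite -ltnS.
  by have := h (Ordinal i_n); rewrite /= ltnn hlt.
have i_n : (m' j < n)%N by apply: leq_trans hlt _; rewrite -ltnS.
by have := h (Ordinal i_n); rewrite /= ltnn hlt.
Qed.

Lemma unit_interval_positroids :
  [set M : matroid 'I_(n + n) | `[< unit_interval_positroid R M >]]
  = dyck_matroid @: dyck_ffuns.
Proof.
apply/setP=> M; rewrite inE; apply/asboolP/imsetP => [/unit_interval_positroidP|].
  move=> [m [dm MB]]; have mn b : (b < n)%N -> (m b <= n)%N.
    by move=> bn; have := dm.2 b bn; lia.
  have E a : (a < n)%N -> heights_of [ffun b : 'I_n => inord (m b)] a = m a.
    exact: heights_of_ffun.
  exists [ffun b : 'I_n => inord (m b)].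
    rewrite inE; apply/asboolP; split=> [a b /andP[ab bn]|a an].
      by rewrite !E ?(leq_ltn_trans ab) //; apply: dm.1; rewrite ab.
    by rewrite E //; exact: dm.2.
  apply: val_inj; rewrite /= MB; congr (mx_bases (row_mx _ _)).
  by apply/matrixP=> i j; rewrite !mxE E.
move=> [m]; rewrite inE => /asboolP dm ->; apply/unit_interval_positroidP.
by exists (heights_of m).
Qed.

Lemma card_unit_interval_positroids :
  (n.+1 * #|[set M : matroid 'I_(n + n) | `[< unit_interval_positroid R M >]]|
   = 'C(2 * n, n))%N.
Proof.
rewrite unit_interval_positroids card_imset; last exact: dyck_matroid_inj.
by rewrite card_dyck_ffuns size_dyck_seqs_diag.
Qed.

End Counting.

(** * Decorated permutations *)

(** Every necklace step trades [y] for [f y], so the fixed-point clauses are vacuous and the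
    necklace leaves only the condition on [f]. *)
Lemma associated_permP (R : realType) (n : nat) (m : nat -> nat)
    (M : matroid 'I_(n + n)) (p : decorated_perm (n + n))
    (f : 'I_(n + n) -> 'I_(n + n)) :
  dyck n m -> represented_by M (dyck_mx R n m) ->
  (forall y, pred_edge n m (f y) y) ->
  associated_perm M p <-> forall y, p (f y) = y.
Proof.
move=> dm MB fP; have step I y := necklace_step dm (fP y) MB (I := I).
split=> [[I [nI pI]] y|pf].
  have [yI xI Iy] := step I y nI; have [h _ _] := pI y.
  by apply: h Iy => //; apply: contraNneq xI => ->.
have [I nI] := exists_necklace MB; exists I; split=> // y.
have [yI xI Iy] := step I y nI.
have nfix : I (ordS y) <> I y.
  by move=> e; move: xI; rewrite -e Iy setU11.
split=> // j _ _ Ij; suff -> : j = f y by [].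
have : f y \in j |: (I y :\ y) by rewrite -Ij Iy setU11.
by rewrite !inE (negbTE xI) andbF orbF => /eqP.
Qed.

Theorem mainTheorem1 (R : realType) (n : nat) (hn : (1 <= n)%N) :
  (forall p : decorated_perm (n + n),
     (exists M : matroid 'I_(n + n),
        unit_interval_positroid R M /\ associated_perm M p)
     <->
     (exists (one : 'I_(n + n)) (js : seq 'I_(n + n)),
        [/\ one = 0%N :> nat,
            full_cycle_notation p (one :: js),
            small_increasing_large_decreasing (one :: js)
          & prefixes_dominated (one :: js)]))
  /\
  (#|[set M : matroid 'I_(n + n) | `[< unit_interval_positroid R M >]]|%:R
     = (n.+1%:R)^-1 * 'C(2 * n, n)%:R :> rat).
Proof.
split=> [p|]; last first.
  rewrite -(card_unit_interval_positroids R n) natrM mulKf //.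
  by rewrite pnatr_eq0.
split=> [[M [/unit_interval_positroidP[m [dm MB]] /(associated_permP p dm MB)]]|].
  move=> /(_ _ (dyck_cycle_pred_edge hn dm)) pf.
  have [one [js [one0 dc]]] := dyck_cycle_head hn dm.
  exists one, js; rewrite -dc; split=> //.
  - split; [exact: size_dyck_cycle|exact: dyck_cycle_uniq|].
    apply: cycle_from_prev; first exact: dyck_cycle_uniq.
    by move=> y _; rewrite /= pf.
  - exact: dyck_cycle_ord.
  - exact: dyck_cycle_dominated.
move=> [one [js [one0 [sc uc pc] oc dom]]].
set c := one :: js in sc uc pc oc dom.
have h0 : index 0%N (map val c) = 0%N by rewrite /= one0.
(* The heights read off the given cycle define a matroid whose predecessor map is [prev c]. *)
have dm := cycle_heights_dyck sc uc oc hn dom h0.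
have [M MB] := matroid_of_mx (dyck_mx_full R n (cycle_heights c)).
exists M; split; first exact: dyck_unit_interval_positroid dm MB.
have pe y := cycle_pred_edge sc uc oc y hn dom h0.
apply/(associated_permP p dm MB pe) => y.
by have /eqP := prev_cycle pc (mem_full_cycle sc uc y).
Qed.
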